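(* Let $G$ be a finitely presented group and suppose that $G$ contains a finitely generated submonoid in which membership is undecidable. Then there is a finite group presentation $\langle A\mid R\rangle$ for the free product $G*\mathbb{Z}$ such that there is no algorithm that takes a word $w\in(A\cup A^{-1})^*$ as input and decides whether $w$ can be written as a positive word, that is, whether there exists a word $\pi_w\in A^*$ such that $w=\pi_w$ in $\langle A\mid R\rangle$.
   Context: $A^*$ denotes the set of all words over $A$, including the empty word. For a group $G$ generated by a finite set $B$ and a finitely generated submonoid $M\leq G$, membership in $M$ is undecidable if there is no algorithm that takes an arbitrary word over $B\cup B^{-1}$ and decides whether the element of $G$ it represents belongs to $M$. *)

(* Defs.v *)
From HB Require Import structures.
From mathcomp Require Import all_boot all_order ssralg ssrnum ssrint.
From mathcomp Require Import generic_quotient.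
From mathcomp Require Import boolp classical_sets.

Set Implicit Arguments.
Unset Strict Implicit.
Unset Printing Implicit Defensive.

Local Open Scope quotient_scope.
Local Open Scope classical_set_scope.
Local Open Scope group_scope.

(* A word over A \cup A^-1: the letter (a, false) stands for a and the letter *)
(* (a, true) for a^-1.                                                        *)
Notation word A := (seq (A * bool)).

Definition inv_letter (A : Type) (x : A * bool) : A * bool := (x.1, ~~ x.2).
Definition inv_word (A : Type) (w : word A) : word A := rev (map (@inv_letter A) w).
Definition pos_word (A : Type) (u : seq A) : word A := [seq (a, false) | a <- u].

Definition eval_word (G : groupType) (A : Type) (b : A -> G) (w : word A) : G :=
  \big[*%g/1]_(x <- w) (if x.2 then (b x.1)^-1 else b x.1).

(* The equality of words in <A | R>, where R is a set of relators: words are  *)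
(* equal when one is obtained from the other by inserting and deleting        *)
(* subwords a a^-1, a^-1 a and relators.                                      *)
Inductive pres_eq (A : Type) (R : set (word A)) : word A -> word A -> Prop :=
| pres_eq_refl u : pres_eq R u u
| pres_eq_sym u v : pres_eq R u v -> pres_eq R v u
| pres_eq_trans u v w : pres_eq R u v -> pres_eq R v w -> pres_eq R u w
| pres_eq_cancel u v x : pres_eq R (u ++ [:: x; inv_letter x] ++ v) (u ++ v)
| pres_eq_relator u v r : R r -> pres_eq R (u ++ r ++ v) (u ++ v).

Section PresentedGroup.
Variables (A : choiceType) (R : set (word A)).
Implicit Types u v w : word A.
Local Notation "u ~ v" := (pres_eq R u v) (at level 70).

Lemma pres_eq_catr u v w : u ~ v -> u ++ w ~ v ++ w.
Proof.
elim=> {u v}; [by move=> *; constructor | by move=> *; constructor | | |].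
- by move=> u v t _ uv _ vt; apply: pres_eq_trans uv vt.
- by move=> u v x; rewrite -!catA; apply: pres_eq_cancel.
- by move=> u v r Rr; rewrite -!catA; apply: pres_eq_relator.
Qed.

Lemma pres_eq_catl u v w : u ~ v -> w ++ u ~ w ++ v.
Proof.
elim=> {u v}; [by move=> *; constructor | by move=> *; constructor | | |].
- by move=> u v t _ uv _ vt; apply: pres_eq_trans uv vt.
- by move=> u v x; rewrite !(catA w); apply: pres_eq_cancel.
- by move=> u v r Rr; rewrite !(catA w); apply: pres_eq_relator.
Qed.

Lemma inv_letterK : involutive (@inv_letter A).
Proof. by case=> a e; rewrite /inv_letter /= negbK. Qed.

Lemma inv_wordK : involutive (@inv_word A).
Proof.
move=> w; rewrite /inv_word map_rev revK -map_comp -[RHS]map_id.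
by apply: eq_map => x /=; rewrite inv_letterK.
Qed.

Lemma pres_eq_mulwV w : w ++ inv_word w ~ [::].
Proof.
elim/last_ind: w => [|w x IHw]; first exact: pres_eq_refl.
rewrite /inv_word map_rcons rev_rcons -cats1 -catA.
exact: pres_eq_trans (pres_eq_cancel R w (inv_word w) x) IHw.
Qed.

Lemma pres_eq_mulVw w : inv_word w ++ w ~ [::].
Proof. by rewrite -{2}(inv_wordK w); apply: pres_eq_mulwV. Qed.

Lemma pres_eq_inv u v : u ~ v -> inv_word u ~ inv_word v.
Proof.
move=> uv; apply: (@pres_eq_trans _ _ _ (inv_word u ++ v ++ inv_word v)).
  rewrite -{1}[inv_word u]cats0; apply/pres_eq_catl/pres_eq_sym.
  exact: pres_eq_mulwV.
rewrite catA -{2}[inv_word v]cat0s; apply: pres_eq_catr.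
apply: pres_eq_trans (pres_eq_mulVw u); apply/pres_eq_catl.
exact: pres_eq_sym.
Qed.

Definition pres_eqb : rel (word A) := fun u v => `[< u ~ v >].

Lemma pres_eqb_equiv : equiv_class_of pres_eqb.
Proof.
split=> [u | u v | v u w].
- exact/asboolP/pres_eq_refl.
- by apply/asboolP/asboolP => /pres_eq_sym.
- by move=> /asboolP uv /asboolP vw; apply/asboolP; apply: pres_eq_trans uv vw.
Qed.

Canonical pres_equiv := EquivRelPack pres_eqb_equiv.

Definition presented : Type := {eq_quot pres_equiv}.
HB.instance Definition _ := Choice.on presented.

Definition class_of (w : word A) : presented := \pi_({eq_quot pres_equiv}) w.
Definition class_repr (x : presented) : word A := repr (x : {eq_quot pres_equiv}).

Lemma class_reprK x : class_of (class_repr x) = x.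
Proof. exact: reprK. Qed.

Lemma class_ofP u v : class_of u = class_of v <-> u ~ v.
Proof.
by split=> [/eqP | uv]; [rewrite eqmodE => /asboolP | apply/eqmodP/asboolP].
Qed.

Lemma class_of_repr w : class_repr (class_of w) ~ w.
Proof. by apply/class_ofP; rewrite class_reprK. Qed.

Definition pres_one : presented := class_of [::].
Definition pres_mul (x y : presented) := class_of (class_repr x ++ class_repr y).
Definition pres_inv (x : presented) := class_of (inv_word (class_repr x)).

Lemma pres_mulE u v : pres_mul (class_of u) (class_of v) = class_of (u ++ v).
Proof.
apply/class_ofP; apply: (@pres_eq_trans _ _ _ (u ++ class_repr (class_of v))).
- exact/pres_eq_catr/class_of_repr.
- exact/pres_eq_catl/class_of_repr.
Qed.

Lemma pres_invE u : pres_inv (class_of u) = class_of (inv_word u).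
Proof. exact/class_ofP/pres_eq_inv/class_of_repr. Qed.

Lemma pres_mulA : associative pres_mul.
Proof.
move=> x y z; rewrite -(class_reprK x) -(class_reprK y) -(class_reprK z).
by rewrite !pres_mulE catA.
Qed.

Lemma pres_mul1 : left_id pres_one pres_mul.
Proof. by move=> x; rewrite -(class_reprK x) pres_mulE. Qed.

Lemma pres_mulr1 : right_id pres_one pres_mul.
Proof. by move=> x; rewrite -(class_reprK x) pres_mulE cats0. Qed.

Lemma pres_mulV : left_inverse pres_one pres_inv pres_mul.
Proof.
move=> x; rewrite -(class_reprK x) pres_invE pres_mulE.
exact/class_ofP/pres_eq_mulVw.
Qed.

Lemma pres_mulrV : right_inverse pres_one pres_inv pres_mul.
Proof.
move=> x; rewrite -(class_reprK x) pres_invE pres_mulE.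
exact/class_ofP/pres_eq_mulwV.
Qed.

HB.instance Definition _ := isGroup.Build presented
  pres_mulA pres_mul1 pres_mulr1 pres_mulV pres_mulrV.

End PresentedGroup.

Definition fin_presented (n : nat) (R : seq (word 'I_n)) : groupType :=
  presented [set r | r \in R].

Definition fin_class (n : nat) (R : seq (word 'I_n)) (w : word 'I_n) :
  fin_presented R := class_of _ w.

Definition isomorphic (G H : groupType) : Prop :=
  exists f : {multiplicative G -> H}, bijective f.

Definition finitely_presented (G : groupType) : Prop :=
  exists (n : nat) (R : seq (word 'I_n)), isomorphic (fin_presented R) G.

(* The free product of G and H is the group whose generators are the elements *)
(* of the disjoint union of G and H and whose relators are the multiplication *)
(* tables of G and H. See free_product_universal below.                       *)
Section FreeProduct.
Variables G H : groupType.

Definition free_product_relators : set (word (G + H)) := [set r |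
  (exists x y : G,
     r = [:: (inl x, false); (inl y, false); (inl (x * y), true)]) \/
  (exists x y : H,
     r = [:: (inr x, false); (inr y, false); (inr (x * y), true)])].

Definition free_product : groupType := presented free_product_relators.

Definition free_inl (x : G) : free_product := class_of _ [:: (inl x, false)].
Definition free_inr (y : H) : free_product := class_of _ [:: (inr y, false)].

End FreeProduct.

Lemma eval_word_cat (G : groupType) A (b : A -> G) (u v : word A) :
  eval_word b (u ++ v) = eval_word b u * eval_word b v.
Proof. exact: big_cat. Qed.

Lemma eval_word_pres_eq (G : groupType) A (b : A -> G) (R : set (word A)) u v :
  (forall r, R r -> eval_word b r = 1) ->
  pres_eq R u v -> eval_word b u = eval_word b v.
Proof.
move=> bR; elim=> {u v} // [u v w _ -> _ -> // | u v [a e] | u v r Rr].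
- rewrite !eval_word_cat; congr (_ * _); rewrite -[RHS]mul1g; congr (_ * _).
  rewrite /eval_word !big_cons big_nil /= mulg1.
  by case: e; rewrite ?mulgV ?mulVg.
- by rewrite !eval_word_cat (bR r Rr) mul1g.
Qed.

Section FreeProductUniversal.
Variables G H : groupType.

Lemma free_inlM : {morph @free_inl G H : x y / x * y}.
Proof.
move=> x y; apply/esym; rewrite /free_inl [LHS]pres_mulE /=; apply/class_ofP.
pose r := [:: (inl x, false); (inl y, false); (inl (x * y), true)] : word (G + H).
apply: (@pres_eq_trans _ _ _ (r ++ [:: (inl (x * y), false)])).
  apply/pres_eq_sym; rewrite /r /=.
  exact: (@pres_eq_cancel _ _ [:: (inl x, false); (inl y, false)] [::]
            (inl (x * y), true)).
by apply: (@pres_eq_relator _ _ [::] [:: (inl (x * y), false)] r); left; exists x, y.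
Qed.

Lemma free_inrM : {morph @free_inr G H : x y / x * y}.
Proof.
move=> x y; apply/esym; rewrite /free_inr [LHS]pres_mulE /=; apply/class_ofP.
pose r := [:: (inr x, false); (inr y, false); (inr (x * y), true)] : word (G + H).
apply: (@pres_eq_trans _ _ _ (r ++ [:: (inr (x * y), false)])).
  apply/pres_eq_sym; rewrite /r /=.
  exact: (@pres_eq_cancel _ _ [:: (inr x, false); (inr y, false)] [::]
            (inr (x * y), true)).
by apply: (@pres_eq_relator _ _ [::] [:: (inr (x * y), false)] r); right; exists x, y.
Qed.

Lemma class_of_eval (A : choiceType) (R : set (word A)) w :
  class_of R w = eval_word (fun a => class_of R [:: (a, false)]) w.
Proof.
elim: w => [|[a e] w IHw]; first by rewrite /eval_word big_nil.
rewrite -cat1s eval_word_cat -IHw /eval_word big_seq1 /=.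
by case: e; rewrite ?[(class_of _ _)^-1]pres_invE [RHS]pres_mulE.
Qed.

Lemma free_product_universal (K : groupType)
    (f : {multiplicative G -> K}) (g : {multiplicative H -> K}) :
  exists! h : free_product G H -> K,
    [/\ {morph h : x y / x * y},
        forall x, h (@free_inl G H x) = f x &
        forall y, h (@free_inr G H y) = g y].
Proof.
pose b (z : G + H) : K := match z with inl x => f x | inr y => g y end.
have bR r : @free_product_relators G H r -> eval_word b r = 1.
  by case=> -[x [y ->]]; rewrite /eval_word !big_cons big_nil /= mulg1 mulgA
    gmulfM mulgV.
pose h (x : free_product G H) : K := eval_word b (class_repr x).
have hE w : h (class_of _ w) = eval_word b w.
  exact: eval_word_pres_eq bR (class_of_repr _ w).
exists h; split=> [|h' [h'M h'l h'r]].
  split=> [x y | x | y].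
  - by rewrite -{1}(class_reprK x) -{1}(class_reprK y) [_ * _]pres_mulE hE
      eval_word_cat.
  - by rewrite hE /eval_word big_cons big_nil mulg1.
  - by rewrite hE /eval_word big_cons big_nil mulg1.
have h'1 : h' 1 = 1 by apply: (@mulgI _ (h' 1)); rewrite -h'M !mulg1.
have h'V x : h' x^-1 = (h' x)^-1.
  by apply: (@mulgI _ (h' x)); rewrite -h'M !mulgV.
apply: funext => x; rewrite -(class_reprK x) hE class_of_eval.
rewrite /eval_word (big_morph h' h'M h'1); apply: eq_bigr => -[z e] _ /=.
by case: e; rewrite ?h'V; case: z => z; rewrite /= -?h'l -?h'r.
Qed.

End FreeProductUniversal.

Definition infinite_cyclic : Type := int.
HB.instance Definition _ := Choice.copy infinite_cyclic int.
HB.instance Definition _ := isGroup.Build infinite_cyclic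
  (@GRing.addrA int) (@GRing.add0r int) (@GRing.addr0 int)
  (@GRing.addNr int) (@GRing.addrN int).

Definition submonoid (G : groupType) (M : set G) : Prop :=
  M 1 /\ forall x y, M x -> M y -> M (x * y).

Definition fg_submonoid (G : groupType) (M : set G) : Prop :=
  exists s : seq G, M = smallest (@submonoid G) [set x | x \in s].

Definition generates (G : groupType) (n : nat) (b : 'I_n -> G) : Prop :=
  forall x : G, exists w : word 'I_n, eval_word b w = x.

(* Algorithms are partial recursive functions. *)
Inductive recfn : nat -> Type :=
| RZero n : recfn n
| RSucc : recfn 1
| RProj n (i : 'I_n) : recfn n
| RComp m n (f : recfn m) (g : 'I_m -> recfn n) : recfn n
| RPrec n (f : recfn n) (g : recfn n.+2) : recfn n.+1
| RMu n (f : recfn n.+1) : recfn n.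

(* computes f v y: the computation of f on v halts with the value y. In the   *)
(* case of primitive recursion, t lists the values at 0, ..., thead v.        *)
Fixpoint computes (n : nat) (f : recfn n) : n.-tuple nat -> nat -> Prop :=
  match f in recfn n return n.-tuple nat -> nat -> Prop with
  | RZero _ => fun _ y => y = 0
  | RSucc => fun v y => y = (thead v).+1
  | RProj _ i => fun v y => y = tnth v i
  | RComp m _ f g => fun v y =>
      exists2 u : m.-tuple nat,
        forall i, computes (g i) v (tnth u i) & computes f u y
  | RPrec _ f g => fun v y =>
      exists t : nat -> nat,
        [/\ computes f [tuple of behead v] (t 0),
            forall i, i < thead v ->
              computes g [tuple of i :: t i :: behead v] (t i.+1) &
            y = t (thead v)]
  | RMu _ f => fun v y =>
      computes f [tuple of y :: v] 0 /\
      forall i, i < y -> exists z, computes f [tuple of i :: v] z.+1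
  end.

Lemma computes_fun n (f : recfn n) v y z :
  computes f v y -> computes f v z -> y = z.
Proof.
elim: f v y z => {n} /=.
- by move=> n v y z -> ->.
- by move=> v y z -> ->.
- by move=> n i v y z -> ->.
- move=> m n f IHf g IHg v y z [u gu fu] [u' gu' fu'].
  have eq_uu' : u = u' by apply: eq_from_tnth => i; apply: IHg (gu i) (gu' i).
  by rewrite -eq_uu' in fu'; apply: IHf fu fu'.
- move=> n f IHf g IHg v y z [t [t0 tS ->]] [t' [t'0 t'S ->]].
  elim: (thead v) tS t'S => [|k IHk] tS t'S; first exact: IHf t0 t'0.
  have eq_tt' : t k = t' k.
    by apply: IHk => i ik; [apply: tS | apply: t'S]; apply: ltnW.
  by move: (tS k (ltnSn k)) (t'S k (ltnSn k)); rewrite -eq_tt'; apply: IHg.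
- move=> n f IHf v y z [fy fy'] [fz fz'].
  by case: (ltngtP y z) => // lt_yz; [case: (fz' y lt_yz) | case: (fy' z lt_yz)]
    => k fk; [have := IHf _ _ _ fy fk | have := IHf _ _ _ fz fk].
Qed.

(* A word over 'I_n is given to an algorithm as the number it denotes in base *)
(* 2n + 1, least significant digit first, where the digits of (a, false) and  *)
(* (a, true) are 2a + 1 and 2a + 2. The digit 0 is not used, so that distinct *)
(* words have distinct codes.                                                 *)
Definition letter_digit (n : nat) (x : 'I_n * bool) : nat := (x.1.*2 + x.2).+1.

Definition word_code (n : nat) (w : word 'I_n) : nat :=
  foldr (fun x c => letter_digit x + n.*2.+1 * c)%N 0 w.

Lemma word_code_inj n : injective (@word_code n).
Proof.
have dlt (x : 'I_n * bool) : letter_digit x < n.*2.+1.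
  case: x => a e; rewrite /letter_digit /= ltnS.
  apply: (@leq_trans a.+1.*2); last by rewrite leq_double.
  by rewrite doubleS ltnS -[leqRHS]addn1 leq_add2l; case: e.
elim=> [|x u IHu] [|y v] //= e.
have exy : letter_digit x = letter_digit y.
  move/(congr1 (modn^~ n.*2.+1)): (e).
  by rewrite !(addnC (letter_digit _)) !(mulnC n.*2.+1) !modnMDl !modn_small.
move: e; rewrite exy => /addnI/eqP; rewrite eqn_pmul2l // => /eqP/IHu ->.
congr (_ :: _); case: x y exy => [a c] [a' c'] [] /=.
move=> e; have ec : c = c'.
  by move/(congr1 odd): (e); rewrite !oddD !odd_double !oddb.
by move: e; rewrite -ec => /addIn/double_inj/val_inj ->.
Qed.

Definition decidable_words (n : nat) (P : word 'I_n -> Prop) : Prop :=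
  exists f : recfn 1, forall w : word 'I_n,
    (P w -> computes f [tuple word_code w] 1) /\
    (~ P w -> computes f [tuple word_code w] 0).

Definition decidable_membership (G : groupType) (n : nat) (b : 'I_n -> G)
    (M : set G) : Prop :=
  decidable_words (fun w => M (eval_word b w)).

(* Main.v *)
Require Import Defs.
From HB Require Import structures.
From mathcomp Require Import all_boot all_order ssralg ssrnum ssrint.
From mathcomp Require Import boolp classical_sets.
From mathcomp Require Import zify.

Set Implicit Arguments.
Unset Strict Implicit.
Unset Printing Implicit Defensive.

(** Let t generate the infinite cyclic factor, let b_1, ..., b_k generate G and
let m_1, ..., m_p generate the submonoid M. The set A consisting of t, of the
b_j t and of the m_l generates G * Z, because b_j = (b_j t) t^-1. The submonoid
generated by A meets G exactly in M: the homomorphism from G * Z to Z that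
kills G and maps t to 1 takes the value 1 on t and on b_j t, and 0 on m_l, so
a positive word over A whose value lies in G cannot use the letters t and
b_j t. It is thus a product of elements m_l ([positive_in_submonoid]).

Replacing each letter b_j by (b_j t) t^-1 turns a word w over the b_j into a
word over A with the same value, and the new word is equal to a positive word
if and only if w represents an element of M. An algorithm for positivity over
A would hence give one for membership in M, provided that the substitution is
computable. Every letter, inverted or not, is replaced by two letters, so the
i-th digit of the code of w contributes a number that depends on this digit
alone, shifted by 2i places, to the code of the new word. Such a sum is
primitive recursive ([recursive_word_subst], [decidable_words_subst]).

It remains to present G * Z on the generators A by finitely many relators.
Adding t to a finite presentation of G presents G * Z
([presents_free_product_cyclic]), and a group with a finite presentation has
one on any finite generating family ([presents_change_generators]). *)

(** * Recursive functions *)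

Section RecursiveFunctions.
Local Open Scope nat_scope.

Definition recursive (n : nat) (F : n.-tuple nat -> nat) : Prop :=
  exists f : recfn n, forall v, computes f v (F v).

Lemma eq_recursive n (F F' : n.-tuple nat -> nat) :
  F =1 F' -> recursive F -> recursive F'.
Proof. by move=> eqF [f fF]; exists f => v; rewrite -eqF. Qed.

Lemma recursive_proj n (i : 'I_n) : recursive (fun v => tnth v i).
Proof. by exists (RProj i). Qed.

Lemma recursive_comp m n (F : m.-tuple nat -> nat)
    (H : 'I_m -> n.-tuple nat -> nat) :
  recursive F -> (forall i, recursive (H i)) ->
  recursive (fun v => F [tuple H i v | i < m]).
Proof.
move=> [f fF] /choice[h hH]; exists (RComp f h) => v /=.
exists [tuple H i v | i < m] => // i.
by rewrite tnth_mktuple; apply: hH.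
Qed.

Lemma recursive_succ n (F : n.-tuple nat -> nat) :
  recursive F -> recursive (fun v => (F v).+1).
Proof.
move=> recF; have recS : recursive (fun u : 1.-tuple nat => (thead u).+1).
  by exists RSucc.
have := recursive_comp recS (fun=> recF).
by apply: eq_recursive => v; rewrite /thead tnth_mktuple.
Qed.

Lemma recursive_const n c : recursive (fun _ : n.-tuple nat => c).
Proof.
elim: c => [|c]; last exact: recursive_succ.
by exists (RZero n).
Qed.

Lemma behead_tupleK n (T : Type) (x : T) (v : n.-tuple T) :
  [tuple of behead [tuple of x :: v]] = v.
Proof. exact: val_inj. Qed.

Lemma recursive_behead n (F : n.-tuple nat -> nat) :
  recursive F -> recursive (fun v : n.+1.-tuple nat => F [tuple of behead v]).
Proof.
move=> recF.
have := recursive_comp recF (fun i : 'I_n => recursive_proj (lift ord0 i)).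
apply: eq_recursive => v; congr F; apply: eq_from_tnth => i.
by rewrite tnth_mktuple; case/tupleP: v => x v; rewrite tnthS behead_tupleK.
Qed.

Lemma recursive_thead n : recursive (fun v : n.+1.-tuple nat => thead v).
Proof. exact: recursive_proj. Qed.

Lemma recursive_thead_behead n :
  recursive (fun v : n.+2.-tuple nat => thead [tuple of behead v]).
Proof. exact: recursive_behead (recursive_thead n). Qed.

(** Primitive recursion, with a bound that is itself a function of the
arguments: the bound is substituted for the recursion variable. *)
Lemma recursive_iteri n (N F : n.-tuple nat -> nat)
    (s : nat -> nat -> n.-tuple nat -> nat) :
  recursive N -> recursive F ->
  recursive (fun u : n.+2.-tuple nat =>
    s (thead u) (thead [tuple of behead u])
      [tuple of behead [tuple of behead u]]) ->
  recursive (fun v => iteri (N v) (fun i x => s i x v) (F v)).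
Proof.
move=> recN [f fF] [g gs].
pose P (v : n.+1.-tuple nat) :=
  iteri (thead v) (fun i x => s i x [tuple of behead v]) (F [tuple of behead v]).
have recP : recursive P.
  exists (RPrec f g) => v /=.
  exists (fun k => iteri k (fun i x => s i x [tuple of behead v])
    (F [tuple of behead v])); split=> //= i _.
  set x := iteri i _ _.
  have := gs [tuple of i :: x :: behead v].
  by rewrite behead_tupleK behead_tupleK.
pose H (i : 'I_n.+1) (v : n.-tuple nat) :=
  if unlift ord0 i is Some j then tnth v j else N v.
have recH i : recursive (H i).
  rewrite /H; case: (unlift _ i) => [j|]; [exact: recursive_proj|exact: recN].
have := recursive_comp recP recH; apply: eq_recursive => v.
have -> : [tuple H i v | i < n.+1] = [tuple of N v :: v].
  apply: eq_from_tnth => i; rewrite tnth_mktuple /H.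
  by case: unliftP => [j ->|->]; rewrite ?tnthS ?tnth0.
by rewrite /P theadE behead_tupleK.
Qed.

Lemma recursive_add n (F H : n.-tuple nat -> nat) :
  recursive F -> recursive H -> recursive (fun v => F v + H v).
Proof.
move=> recF recH.
apply: (@eq_recursive _ (fun v => iteri (H v) (fun _ x => x.+1) (F v))).
  by move=> v; elim: (H v) => [|m /= ->]; rewrite ?addn0 ?addnS.
apply: (@recursive_iteri _ _ _ (fun _ x _ => x.+1)) => //.
exact/recursive_succ/recursive_thead_behead.
Qed.

Lemma recursive_mul n (F H : n.-tuple nat -> nat) :
  recursive F -> recursive H -> recursive (fun v => F v * H v).
Proof.
move=> recF recH.
apply: (@eq_recursive _ (fun v => iteri (H v) (fun _ x => x + F v) 0)).
  by move=> v; elim: (H v) => [|m /= ->]; rewrite ?muln0 ?mulnS // addnC.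
apply: (@recursive_iteri _ _ (fun=> 0) (fun _ x v => x + F v)) => //.
  exact: recursive_const.
apply: recursive_add; first exact: recursive_thead_behead.
exact: recursive_behead (recursive_behead recF).
Qed.

Lemma recursive_exp n c (F : n.-tuple nat -> nat) :
  recursive F -> recursive (fun v => c ^ F v).
Proof.
move=> recF.
apply: (@eq_recursive _ (fun v => iteri (F v) (fun _ x => x * c) 1)).
  by move=> v; elim: (F v) => //= m ->; rewrite expnSr.
apply: (@recursive_iteri _ _ (fun=> 1) (fun _ x _ => x * c)) => //.
  exact: recursive_const.
by apply: recursive_mul; [exact: recursive_thead_behead|exact: recursive_const].
Qed.

(** Any function with a finite table is recursive: reading a list at m.+1 is
one step of a recursion that ignores the previous value. *)
Lemma recursive_nth n (s : seq nat) (F : n.-tuple nat -> nat) :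
  recursive F -> recursive (fun v => nth 0 s (F v)).
Proof.
elim: s n F => [|x s IHs] n F recF.
  by apply: eq_recursive (recursive_const _ 0) => v; rewrite nth_nil.
apply: (@eq_recursive _ (fun v => iteri (F v) (fun i _ => nth 0 s i) x)).
  by move=> v; case: (F v).
apply: (@recursive_iteri _ _ (fun=> x) (fun i _ _ => nth 0 s i)) => //.
  exact: recursive_const.
exact/IHs/recursive_thead.
Qed.

Lemma recursive_modn n d (F : n.-tuple nat -> nat) :
  0 < d -> recursive F -> recursive (fun v => F v %% d).
Proof.
(* The residue of m.+1 is read off from that of m in a table. *)
move=> d_gt0 recF; pose t := mkseq (fun x => x.+1 %% d) d.
apply: (@eq_recursive _ (fun v => iteri (F v) (fun _ x => nth 0 t x) 0)).
  move=> v; elim: (F v) => [|m /= ->]; first by rewrite mod0n.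
  by rewrite nth_mkseq ?ltn_mod // -addn1 modnDml addn1.
apply: (@recursive_iteri _ _ (fun=> 0) (fun _ x _ => nth 0 t x)) => //.
  exact: recursive_const.
exact/recursive_nth/recursive_thead_behead.
Qed.

Lemma recursive_divn n d (F : n.-tuple nat -> nat) :
  0 < d -> recursive F -> recursive (fun v => F v %/ d).
Proof.
(* The quotient grows by 1 at each multiple of d; the list [:: 1] serves as the
   test for 0. *)
move=> d_gt0 recF.
apply: (@eq_recursive _ (fun v =>
  iteri (F v) (fun i x => nth 0 [:: 1] (i.+1 %% d) + x) 0)).
  move=> v; elim: (F v) => [|m /= ->]; first by rewrite div0n.
  by rewrite divnS // /dvdn; case: (_ %% _) => [|[]].
apply: (@recursive_iteri _ _ (fun=> 0)
  (fun i x _ => nth 0 [:: 1] (i.+1 %% d) + x)) => //.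
  exact: recursive_const.
apply: recursive_add; last exact: recursive_thead_behead.
exact/recursive_nth/recursive_modn/recursive_succ/recursive_thead.
Qed.

Lemma recursive_divn_exp n d (F H : n.-tuple nat -> nat) :
  0 < d -> recursive F -> recursive H -> recursive (fun v => F v %/ d ^ H v).
Proof.
move=> d_gt0 recF recH.
apply: (@eq_recursive _ (fun v => iteri (H v) (fun _ x => x %/ d) (F v))).
  move=> v; elim: (H v) => [|m /= ->]; first by rewrite divn1.
  by rewrite expnSr divnMA.
apply: (@recursive_iteri _ _ _ (fun _ x _ => x %/ d)) => //.
exact/recursive_divn/recursive_thead_behead.
Qed.

(** * Substitutions on the codes of words *)

Lemma letter_digit_lt n (x : 'I_n * bool) : letter_digit x < n.*2.+1.
Proof. by case: x => a []; rewrite /letter_digit /=; have := ltn_ord a; lia. Qed.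

Lemma size_word_code n (w : word 'I_n) : size w <= word_code w.
Proof.
elim: w => //= x w IHw; rewrite /letter_digit addSn ltnS.
apply: leq_trans (leq_addl _ _); apply: leq_trans IHw _.
by rewrite mulSn leq_addr.
Qed.

Lemma word_code_cat n (u v : word 'I_n) :
  word_code (u ++ v) = word_code u + n.*2.+1 ^ size u * word_code v.
Proof.
elim: u => [|x u IHu]; first by rewrite mul1n.
by rewrite /= IHu mulnDr addnA mulnA -expnS.
Qed.

Lemma word_code_divn n (x : 'I_n * bool) w :
  word_code (x :: w) %/ n.*2.+1 = word_code w.
Proof.
by rewrite /= addnC mulnC divnMDl // divn_small ?addn0 ?letter_digit_lt.
Qed.

Lemma word_code_modn n (x : 'I_n * bool) w :
  word_code (x :: w) %% n.*2.+1 = letter_digit x.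
Proof. by rewrite /= addnC mulnC modnMDl modn_small ?letter_digit_lt. Qed.

Lemma iteri_sum (f : nat -> nat) m :
  iteri m (fun i x => x + f i) 0 = \sum_(i < m) f i.
Proof. by elim: m => [|m /= ->]; rewrite ?big_ord0 // big_ord_recr. Qed.

(** Replacing letters by words of one common length l makes the position of
each image in the code of the result depend only on the position of the letter,
which permits the closed formula [code_image] below. *)
Section UniformSubstitution.
Variables (k n l : nat) (sigma : 'I_k * bool -> word 'I_n).
Hypothesis size_sigma : forall x, size (sigma x) = l.

Let B := k.*2.+1.
Let C := n.*2.+1 ^ l.
(* The digit 0, which codes no letter, contributes 0. *)
Let digit_value := mkseq (fun d =>
  if [pick x | letter_digit x == d] is Some x then word_code (sigma x) else 0) B.

Let digit_value0 : nth 0 digit_value 0 = 0.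
Proof. by rewrite nth_mkseq //; case: pickP. Qed.

Let digit_valueE x : nth 0 digit_value (letter_digit x) = word_code (sigma x).
Proof.
rewrite nth_mkseq ?letter_digit_lt //; case: pickP => [y /eqP eq_yx|/(_ x)].
  suff [->] : [:: y] = [:: x] by [].
  by apply: word_code_inj; rewrite /= eq_yx.
by rewrite eqxx.
Qed.

Let code_image c N :=
  \sum_(i < N) C ^ i * nth 0 digit_value (c %/ B ^ i %% B).

(** The sum may run beyond the end of the word, where all digits are 0. In
particular the code of the word itself can serve as the bound. *)
Let code_imageE w N : size w <= N ->
  code_image (word_code w) N = word_code (flatten (map sigma w)).
Proof.
rewrite /code_image; elim: w N => [|x w IHw] N.
  by move=> _; apply: big1 => i _; rewrite div0n mod0n digit_value0 muln0.
case: N => // N /IHw IH.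
rewrite big_ord_recl mul1n divn1 word_code_modn digit_valueE.
rewrite [RHS]word_code_cat size_sigma -IH big_distrr /=; congr (_ + _).
by apply: eq_bigr => i _; rewrite !expnS divnMA word_code_divn mulnA.
Qed.

Lemma recursive_word_subst : exists2 F : 1.-tuple nat -> nat,
  recursive F &
  forall w, F [tuple word_code w] = word_code (flatten (map sigma w)).
Proof.
exists (fun v => code_image (thead v) (thead v)); last first.
  by move=> w; rewrite code_imageE ?size_word_code.
apply: (@eq_recursive _ (fun v => iteri (thead v) (fun i x =>
    x + C ^ i * nth 0 digit_value (thead v %/ B ^ i %% B)) 0)).
  by move=> v; rewrite iteri_sum.
apply: (@recursive_iteri _ _ (fun=> 0) (fun i x v =>
    x + C ^ i * nth 0 digit_value (thead v %/ B ^ i %% B))).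
- exact: recursive_thead.
- exact: recursive_const.
apply: recursive_add; first exact: recursive_thead_behead.
apply: recursive_mul; first exact/recursive_exp/recursive_thead.
apply/recursive_nth/recursive_modn/recursive_divn_exp => //.
  exact: recursive_behead (recursive_behead (@recursive_thead 0)).
exact: recursive_thead.
Qed.

(** Decidability is inherited along the many-one reduction of Q to P given by
the substitution. *)
Lemma decidable_words_subst (P : word 'I_n -> Prop) (Q : word 'I_k -> Prop) :
    (forall w, Q w <-> P (flatten (map sigma w))) ->
  decidable_words P -> decidable_words Q.
Proof.
move=> QP [f fP]; have [F [h hF] Fw] := recursive_word_subst.
exists (RComp f (fun _ : 'I_1 => h)) => w; rewrite QP.
have fh y : computes f [tuple word_code (flatten (map sigma w))] y ->
    computes (RComp f (fun _ : 'I_1 => h)) [tuple word_code w] y.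
  exists [tuple word_code (flatten (map sigma w))] => // i.
  by rewrite (ord1 i) tnth0 -Fw.
by have [P1 P0] := fP (flatten (map sigma w)); split=> [/P1|/P0]; apply: fh.
Qed.

End UniformSubstitution.

End RecursiveFunctions.

Local Open Scope classical_set_scope.
Local Open Scope group_scope.

(** * Values of words *)

Section Morphisms.
Variables (G H : groupType) (f : G -> H).
Hypothesis fM : {morph f : x y / x * y}.

Lemma morph1 : f 1 = 1.
Proof. by apply: (@mulgI _ (f 1)); rewrite -fM !mulg1. Qed.

Lemma morphV x : f x^-1 = (f x)^-1.
Proof. by apply: (@mulgI _ (f x)); rewrite -fM !mulgV morph1. Qed.

Lemma morph_eval_word (A : Type) (b : A -> G) w :
  f (eval_word b w) = eval_word (f \o b) w.
Proof.
rewrite /eval_word (big_morph f fM morph1).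
by apply: eq_bigr => -[a []] _; rewrite //= morphV.
Qed.

End Morphisms.

Section Evaluation.
Variable G : groupType.

Lemma eval_word_gen (A : Type) (b : A -> G) a e :
  eval_word b [:: (a, e)] = if e then (b a)^-1 else b a.
Proof. by rewrite /eval_word big_seq1. Qed.

Lemma eval_word_inv (A : Type) (b : A -> G) w :
  eval_word b (inv_word w) = (eval_word b w)^-1.
Proof.
elim: w => [|x w IHw]; first by rewrite /eval_word !big_nil invg1.
rewrite -cat1s /inv_word map_cat rev_cat !eval_word_cat IHw invgM.
congr (_ * _); rewrite /eval_word !big_seq1 /=.
by case: x => a [] /=; rewrite ?invgK.
Qed.

Lemma eval_pos_word (A : Type) (b : A -> G) u :
  eval_word b (pos_word u) = \prod_(a <- u) b a.
Proof. by rewrite /eval_word big_map. Qed.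

Lemma eq_eval_word (A : Type) (b c : A -> G) : b =1 c -> eval_word b =1 eval_word c.
Proof. by move=> eq_bc w; apply: eq_bigr => x _; rewrite eq_bc. Qed.

End Evaluation.

Section Substitution.
Variables (A B : Type) (sigma : A -> word B).

Definition letter_subst (x : A * bool) : word B :=
  if x.2 then inv_word (sigma x.1) else sigma x.1.
Definition word_subst (w : word A) : word B := flatten (map letter_subst w).

Lemma eval_word_subst (G : groupType) (b : B -> G) w :
  eval_word b (word_subst w) = eval_word (eval_word b \o sigma) w.
Proof.
elim: w => [|x w IHw]; first by rewrite /eval_word !big_nil.
rewrite -[x :: w]cat1s eval_word_cat [LHS]eval_word_cat {}IHw; congr (_ * _).
by case: x => a []; rewrite eval_word_gen /letter_subst /= ?eval_word_inv.
Qed.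

End Substitution.

(** * Presentations on a given family of generators *)

(** The map from words to G induces an isomorphism of the presented group onto
G. Unlike [isomorphic], this records which elements of G the generators are. *)
Definition presents (G : groupType) n (b : 'I_n -> G) (R : seq (word 'I_n)) :=
  generates b /\
  forall u v, eval_word b u = eval_word b v <-> pres_eq [set r | r \in R] u v.

Lemma eval_relator (A : choiceType) (R : set (word A)) r : R r ->
  eval_word (fun a => class_of R [:: (a, false)]) r = 1.
Proof.
move=> Rr; rewrite -class_of_eval; apply/class_ofP.
by have := @pres_eq_relator _ R [::] [::] r Rr; rewrite cats0.
Qed.

Lemma presents_relator (G : groupType) n (b : 'I_n -> G) R r :
  presents b R -> r \in R -> eval_word b r = 1.
Proof.
case=> _ bR Rr; transitivity (eval_word b [::]).
  by apply/bR; have := @pres_eq_relator _ [set r | r \in R] [::] [::] r Rr;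
    rewrite cats0.
by rewrite /eval_word big_nil.
Qed.

(** The relators hold in G, and they suffice: this one-sided form is what has to
be checked for a new presentation. *)
Lemma presentsP (G : groupType) n (b : 'I_n -> G) (R : seq (word 'I_n)) :
    generates b -> (forall r, r \in R -> eval_word b r = 1) ->
    (forall u v, eval_word b u = eval_word b v -> fin_class R u = fin_class R v) ->
  presents b R.
Proof.
move=> genb bR Rb; split=> // u v; split; first by move/Rb/class_ofP.
exact: eval_word_pres_eq bR.
Qed.

Lemma presents_exists (G : groupType) :
  finitely_presented G -> exists n (b : 'I_n -> G) R, presents b R.
Proof.
case=> n [R [f f_bij]]; pose b i := f (fin_class R [:: (i, false)]).
have bE w : eval_word b w = f (fin_class R w).
  by rewrite [fin_class R w]class_of_eval (morph_eval_word (@gmulfM _ _ f)).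
exists n, b, R; split=> [x|u v].
  have [g fK gK] := f_bij; exists (class_repr (g x)).
  by rewrite bE [fin_class R _]class_reprK.
rewrite !bE -class_ofP; split=> [/(bij_inj f_bij)//|eq_uv].
by rewrite /fin_class eq_uv.
Qed.

Lemma presents_isomorphic (G : groupType) n (b : 'I_n -> G) R :
  presents b R -> isomorphic (fin_presented R) G.
Proof.
move=> [genb bR]; pose f (x : fin_presented R) := eval_word b (class_repr x).
have fE w : f (fin_class R w) = eval_word b w by apply/bR/class_of_repr.
have fM : {morph f : x y / x * y}.
  by move=> x y; rewrite [LHS]fE eval_word_cat.
have [g gK] := choice genb.
pose F := HB.pack_for {multiplicative fin_presented R -> G} f
  (isMultiplicative.Build _ _ f fM).
exists F; exists (fin_class R \o g); first last.
  by move=> y; rewrite [LHS]fE gK.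
by move=> x; rewrite -[RHS]class_reprK; apply/class_ofP/bR; rewrite gK.
Qed.

(** Finite presentability does not depend on the finite generating family.
The generators b are written as words sigma over a, and conversely a as words
tau over b. The new relators are the old ones rewritten by sigma, together with
the equations that express each a j by tau j rewritten by sigma. In the group
with these relators, every word over a is equal to its rewriting by tau followed
by sigma, and the old relators hold. *)
Lemma presents_change_generators (G : groupType) n (b : 'I_n -> G) R
    m (a : 'I_m -> G) :
  presents b R -> generates a -> exists S, presents a S.
Proof.
move=> bR gena; have [genb eqR] := bR.
have [sigma sigmaE] := choice (fun i => gena (b i)).
have [tau tauE] := choice (fun j => genb (a j)).
pose S := [seq word_subst sigma r | r <- R] ++
  [seq (j, true) :: word_subst sigma (tau j) | j <- enum 'I_m].
have sigmaK w : eval_word a (word_subst sigma w) = eval_word b w.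
  by rewrite eval_word_subst; apply: eq_eval_word.
have tauK w : eval_word b (word_subst tau w) = eval_word a w.
  by rewrite eval_word_subst; apply: eq_eval_word.
exists S; apply: presentsP => // [r|u v].
  rewrite mem_cat => /orP[/mapP[r' Rr' ->]|/mapP[j _ ->]].
    by rewrite sigmaK; apply: presents_relator bR Rr'.
  by rewrite -cat1s eval_word_cat eval_word_gen sigmaK tauE mulVg.
pose alpha j : fin_presented S := fin_class S [:: (j, false)].
pose beta := eval_word alpha \o sigma.
have betaR r : r \in R -> eval_word beta r = 1.
  move=> Rr; rewrite -eval_word_subst; apply: eval_relator => /=.
  by rewrite mem_cat map_f.
have alphaE j : alpha j = eval_word beta (tau j).
  have : eval_word alpha ((j, true) :: word_subst sigma (tau j)) = 1.
    by apply: eval_relator; rewrite /= mem_cat (map_f _ (mem_enum _ j)) orbT.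
  rewrite -cat1s eval_word_cat eval_word_gen eval_word_subst => /mulg1_eq.
  by rewrite invgK.
have classE w : fin_class S w = eval_word beta (word_subst tau w).
  rewrite [LHS]class_of_eval eval_word_subst; exact: eq_eval_word.
move=> eq_uv; rewrite !classE; apply: eval_word_pres_eq betaR _.
by apply/eqR; rewrite !tauK.
Qed.

(** * The free product with an infinite cyclic group *)

Section IntegerPowers.
Variables (K : groupType) (k : K).

Definition zpow (z : infinite_cyclic) : K :=
  match z with Posz n => k ^+ n | Negz n => k ^- n.+1 end.

Let zpowS (z : int) : zpow (z + 1)%R = zpow z * k.
Proof.
case: z => [n|[|n]].
- by rewrite -PoszD addn1 /zpow expgSr.
- by rewrite /zpow /= mulVg.
- have -> : (Negz n.+1 + 1 = Negz n)%R.
    by rewrite !NegzE -[n.+2]addn1 PoszD GRing.opprD GRing.subrK.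
  have -> : zpow (Negz n.+1) = k ^- n.+1 * k^-1 by rewrite -invgM -expgS.
  by rewrite -mulgA mulVg mulg1.
Qed.

Lemma zpowM : {morph zpow : x y / x * y}.
Proof.
move=> x y; change (zpow (x + y :> int)%R = zpow x * zpow y).
elim/int_rect: y => [|n IHn|n IHn].
- by rewrite GRing.addr0 mulg1.
- by rewrite -addn1 PoszD GRing.addrA !zpowS IHn mulgA.
- apply: (@mulIg _ k); rewrite -mulgA -!zpowS -GRing.addrA.
  by rewrite -addn1 PoszD GRing.opprD GRing.subrK IHn.
Qed.

End IntegerPowers.

Lemma morph_zpow (K H : groupType) (f : K -> H) k z :
  {morph f : x y / x * y} -> f (zpow k z) = zpow (f k) z.
Proof.
move=> fM; have fX n : f (k ^+ n) = f k ^+ n.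
  by elim: n => [|n IHn]; rewrite ?expgS ?fM ?IHn // !expg0 (morph1 fM).
by case: z => n; rewrite /zpow ?(morphV fM) fX.
Qed.

Lemma zpow_id (z : infinite_cyclic) : @zpow infinite_cyclic (1%R : int) z = z.
Proof.
have expE n : ((1%R : int) : infinite_cyclic) ^+ n = Posz n.
  by elim: n => [|n IHn] //; rewrite expgSr IHn -addn1 PoszD.
by case: z => n; rewrite /zpow expE.
Qed.

Section FreeProductCyclic.
Variable G : groupType.
Local Notation GZ := (free_product G infinite_cyclic).
Local Notation inG := (@free_inl G infinite_cyclic).

Definition free_generator : GZ := @free_inr G infinite_cyclic (1%R : int).
Local Notation t := free_generator.

(** The universal property of G * Z, in the form in which t can be sent to any
element. *)
Lemma free_product_cyclic_rec (K : groupType) (f : G -> K) (k : K) :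
  {morph f : x y / x * y} ->
  exists h : GZ -> K,
    [/\ {morph h : x y / x * y}, forall x, h (inG x) = f x & h t = k].
Proof.
move=> fM.
pose F := HB.pack_for {multiplicative G -> K} f
  (isMultiplicative.Build _ _ f fM).
pose z := HB.pack_for {multiplicative infinite_cyclic -> K} (zpow k)
  (isMultiplicative.Build _ _ (zpow k) (zpowM k)).
have [h [[hM hG hZ] _]] := free_product_universal F z.
by exists h; split; rewrite // hZ /= expg1.
Qed.

Lemma generates_free_product_cyclic n (a : 'I_n -> GZ) :
  (exists w, eval_word a w = t) ->
  (forall x, exists w, eval_word a w = inG x) -> generates a.
Proof.
move=> gent genG.
have genM x y : (exists w, eval_word a w = x) -> (exists w, eval_word a w = y) ->
    exists w, eval_word a w = x * y.
  by move=> [u <-] [v <-]; exists (u ++ v); rewrite eval_word_cat.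
have genV x : (exists w, eval_word a w = x) -> exists w, eval_word a w = x^-1.
  by move=> [u <-]; exists (inv_word u); rewrite eval_word_inv.
have gen1 : exists w, eval_word a w = 1.
  by exists [::]; rewrite /eval_word big_nil.
have genX m : exists w, eval_word a w = t ^+ m.
  by elim: m => [|m IHm]; rewrite ?expgS //; apply: genM.
have genZ z : exists w, eval_word a w = @free_inr G infinite_cyclic z.
  rewrite -[z]zpow_id (morph_zpow _ _ (@free_inrM _ _)).
  by case: z => m; rewrite /zpow; [|apply: genV]; apply: genX.
move=> x; rewrite -[x]class_reprK class_of_eval /eval_word.
apply: (big_ind (fun z => exists w, eval_word a w = z)) => // -[[y|y] e] _ /=.
all: case: e; try apply: genV.
all: by [apply: genG | apply: genZ].
Qed.

(** The relators of G, together with a new letter for t, suffice: they make the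
map from words over b to the presented group factor through G, so the universal
property gives a homomorphism from G * Z that recovers the class of a word from
its value. *)
Lemma presents_free_product_cyclic n (b : 'I_n -> G) R :
  presents b R ->
  exists m (a : 'I_m -> GZ) S, presents a S.
Proof.
move=> bR; have [genb eqR] := bR.
pose sigma (i : 'I_n) : word 'I_n.+1 := [:: (lift ord0 i, false)].
pose a (i : 'I_n.+1) : GZ := if unlift ord0 i is Some j then inG (b j) else t.
have aE w : eval_word a (word_subst sigma w) = inG (eval_word b w).
  rewrite eval_word_subst (morph_eval_word (@free_inlM _ _)).
  by apply: eq_eval_word => i /=; rewrite eval_word_gen /a liftK.
exists n.+1, a, (map (word_subst sigma) R); apply: presentsP.
- apply: generates_free_product_cyclic => [|x].
    by exists [:: (ord0, false)]; rewrite eval_word_gen /a unlift_none.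
  by have [w <-] := genb x; exists (word_subst sigma w).
- move=> r /mapP[r' Rr' ->]; rewrite aE (presents_relator bR Rr').
  exact: morph1 (@free_inlM _ _).
set S := map _ _; move=> u v eq_uv.
have [f fE] : exists f : G -> fin_presented S,
    forall w, f (eval_word b w) = fin_class S (word_subst sigma w).
  have [g gE] := choice genb; exists (fun x => fin_class S (word_subst sigma (g x))).
  move=> w; rewrite /fin_class !class_of_eval !eval_word_subst.
  apply: (eval_word_pres_eq (R := [set r | r \in R])); last exact/eqR.
  move=> r Rr; rewrite -eval_word_subst; apply: eval_relator.
  exact: map_f.
have fM : {morph f : x y / x * y}.
  move=> x y; have [[u' <-] [v' <-]] := (genb x, genb y).
  rewrite -eval_word_cat !fE /word_subst map_cat flatten_cat.
  by rewrite [RHS]pres_mulE.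
have [h [hM hG ht]] := free_product_cyclic_rec (fin_class S [:: (ord0, false)]) fM.
have hE w : h (eval_word a w) = fin_class S w.
  rewrite [RHS]class_of_eval (morph_eval_word hM); apply: eq_eval_word => i /=.
  rewrite /a; case: unliftP => [j ->|-> //].
  have -> : b j = eval_word b [:: (j, false)] by rewrite eval_word_gen.
  by rewrite hG fE.
by rewrite -!hE eq_uv.
Qed.

(** * A generating family whose positive words meet G in a given submonoid *)

Section PositiveWords.
Variables (k : nat) (b : 'I_k -> G) (s : seq G).

(** Multiplication by t gives b j a positive exponent, which keeps it out of the
positive words with value in G, while b j = (b j * t) * t^-1 is still
generated. *)
Definition twisted_generators (i : 'I_(k.+1 + size s)) : GZ :=
  match split i with
  | inl j => if unlift ord0 j is Some j' then inG (b j') * t else t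
  | inr l => inG (tnth (in_tuple s) l)
  end.
Local Notation a := twisted_generators.

Definition free_index : 'I_(k.+1 + size s) := lshift (size s) ord0.
Definition twisted_index (j : 'I_k) : 'I_(k.+1 + size s) :=
  lshift (size s) (lift ord0 j).

Lemma free_indexE : a free_index = t.
Proof. by rewrite /a (unsplitK (inl _)) unlift_none. Qed.

Lemma twisted_indexE j : a (twisted_index j) = inG (b j) * t.
Proof. by rewrite /a (unsplitK (inl _)) liftK. Qed.

Lemma monoid_indexE l : a (rshift k.+1 l) = inG (tnth (in_tuple s) l).
Proof. by rewrite /a (unsplitK (inr _)). Qed.

Definition untwist (j : 'I_k) : word 'I_(k.+1 + size s) :=
  [:: (twisted_index j, false); (free_index, true)].

Lemma eval_untwist w : eval_word a (word_subst untwist w) = inG (eval_word b w).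
Proof.
rewrite eval_word_subst (morph_eval_word (@free_inlM _ _)).
apply: eq_eval_word => j /=; rewrite /untwist -cat1s eval_word_cat !eval_word_gen.
by rewrite free_indexE twisted_indexE mulgK.
Qed.

Lemma generates_twisted : generates b -> generates a.
Proof.
move=> genb; apply: generates_free_product_cyclic => [|x].
  by exists [:: (free_index, false)]; rewrite eval_word_gen free_indexE.
by have [w <-] := genb x; exists (word_subst untwist w); rewrite eval_untwist.
Qed.

(** The exponent sum of t distinguishes the letters that come from s, where it
is 0, from all the others, where it is 1. Since it is never negative, it
vanishes on a positive word only if all letters come from s. *)
Lemma exponent_sum_hom : exists h : GZ -> infinite_cyclic,
  [/\ {morph h : x y / x * y}, forall x, h (inG x) = 1 &
    forall i, h (a i) = Posz (i < k.+1)%N].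
Proof.
have triv : {morph (fun _ : G => 1 : infinite_cyclic) : x y / x * y}.
  by move=> x y; rewrite mulg1.
have [h [hM hG ht]] :=
  @free_product_cyclic_rec infinite_cyclic _ (1%R : int) triv.
exists h; split=> // i; rewrite /a; case: splitP => [j _|l _]; last by rewrite hG.
by case: unlift => [j'|]; rewrite ?hM ?hG ht ?mul1g.
Qed.

(** If a positive word has its value in G, its exponent sum is 0, so it is a
word in the elements of s; the retraction of G * Z onto G that kills t then carries
this factorisation into G. *)
Lemma positive_in_submonoid x :
  (exists u, inG x = eval_word a (pos_word u)) <->
  smallest (@submonoid G) [set y | y \in s] x.
Proof.
split=> [[u xE] A [[A1 AM] sA]|]; last first.
  pose positive := [set y | exists u, inG y = eval_word a (pos_word u)].
  apply: (@smallest_sub _ _ _ positive) => [|y /= /(@tnthP _ _ (in_tuple s))[l ->]].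
    split=> [|y z [u yE] [v zE]].
      by exists [::]; rewrite eval_pos_word big_nil (morph1 (@free_inlM _ _)).
    exists (u ++ v); rewrite /pos_word map_cat eval_word_cat -yE -zE.
    exact: free_inlM.
  exists [:: rshift k.+1 l].
  by rewrite eval_pos_word big_seq1 monoid_indexE.
have [deg [degM degG degE]] := exponent_sum_hom.
have [rho [rhoM rhoG _]] := free_product_cyclic_rec 1 (fun y z : G => erefl (y * z)).
(* By the exponent sum, u has no letter t or b_j t. *)
have no_t : ~~ has (fun i : 'I_(k.+1 + size s) => i < k.+1)%N u.
  have : deg (inG x) = Posz (count (fun i : 'I_(k.+1 + size s) => i < k.+1)%N u).
    rewrite xE eval_pos_word (big_morph deg degM (morph1 degM)).
    elim: u {xE} => [|i u IHu]; first by rewrite big_nil.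
    by rewrite big_cons degE IHu.
  by rewrite degG has_count => -[<-].
rewrite -[x]rhoG xE eval_pos_word (big_morph rho rhoM (morph1 rhoM)).
elim: u no_t {xE} => [|i u IHu] /=; first by rewrite big_nil.
rewrite big_cons negb_or => /andP[i_k /IHu]; apply: AM.
rewrite /a; case: splitP i_k => // l _ _.
by rewrite rhoG; apply/sA/mem_tnth.
Qed.

End PositiveWords.
End FreeProductCyclic.

Arguments twisted_generators {G k} b s i.

Theorem theorem5p4 (G : groupType) (fpG : finitely_presented G)
    (undecG : exists (k : nat) (b : 'I_k -> G) (M : set G),
       [/\ generates b, fg_submonoid M & ~ decidable_membership b M]) :
  exists (n : nat) (R : seq (word 'I_n)),
    isomorphic (fin_presented R) (free_product G infinite_cyclic) /\
    ~ decidable_words (fun w : word 'I_n =>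
        exists u : seq 'I_n, fin_class R w = fin_class R (pos_word u)).
Proof.
have [k [b [M [genb [s ->] undecM]]]] := undecG.
have [n0 [b0 [R0 /presents_free_product_cyclic[n1 [a0 [R1 R1P]]]]]] :=
  presents_exists fpG.
have [R RP] := presents_change_generators R1P (generates_twisted s genb).
exists (k.+1 + size s), R; split; first exact: presents_isomorphic RP.
move=> dec; apply: undecM.
apply: (decidable_words_subst (l := 2) (sigma := letter_subst (untwist s))
  _ _ dec) => [|w].
  by case=> j [].
rewrite -positive_in_submonoid.
have posE u : fin_class R (word_subst (untwist s) w) = fin_class R (pos_word u) <->
    free_inl _ (eval_word b w) = eval_word (twisted_generators b s) (pos_word u).
  by rewrite -(@eval_untwist _ _ b s) RP.2 -class_ofP.
by split=> -[u /posE]; exists u.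
Qed.
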